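(* Let $Q_1,Q_2$ be sets of snapshots with disjoint domains such that, for each $i\in\{1,2\}$, $Q_i$ has no nonempty finalized subset and every actor of $\mathrm{dom}(Q_i)$ is potentially finalized in $Q_i$. Let $\tilde Q_1,\tilde Q_2$ be their summaries, with all fresh tokens introduced in the two summaries distinct from each other and from all tokens occurring in $Q_1,Q_2$. Then for every $C\in\mathrm{dom}(\tilde Q_1)\cup\mathrm{dom}(\tilde Q_2)$: $C$ is finalized in $\tilde Q_1\cup\tilde Q_2$ if and only if $C$ is finalized in $Q_1\cup Q_2$.
   Context: A refob is a triple $(x,A,B)$ of a token $x$, owner actor $A$ and target actor $B$, written $x: A\to B$. A fact is one of $\mathrm{Created}(x)$, $\mathrm{Released}(x)$, $\mathrm{CreatedUsing}(x,y)$, $\mathrm{Activated}(x)$, $\mathrm{Unreleased}(x)$, $\mathrm{SentCount}(x,n)$, $\mathrm{RecvCount}(x,n)$ ($n\in\mathbb N$). A knowledge set $\Phi$ is a finite set of facts; $\Phi\vdash\varphi$ means $\varphi$ is derivable from $\Phi$ in first-order logic plus the rules: if no $\mathrm{SentCount}(x,n)\in\Phi$ then $\Phi\vdash\mathrm{SentCount}(x,0)$; if no $\mathrm{RecvCount}(x,n)\in\Phi$ then $\Phi\vdash\mathrm{RecvCount}(x,0)$; if $\Phi\vdash\mathrm{Created}(x)$ and $\Phi\not\vdash\mathrm{Released}(x)$ then $\Phi\vdash\mathrm{Unreleased}(x)$; if $\Phi\vdash\mathrm{CreatedUsing}(x,y)$ then $\Phi\vdash\mathrm{Created}(y)$. A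 set of snapshots $Q$ is a finite partial map from actors to knowledge sets; unions are unions of partial maps and subsets are restrictions to subsets of the domain. For a refob $x:A\to B$: $Q\vdash\mathrm{Activated}(x)$, $Q\vdash\mathrm{SentCount}(x,n)$, $Q\vdash\mathrm{CreatedUsing}(x,y)$ mean $A\in\mathrm{dom}(Q)$ and $Q(A)$ derives the fact; $Q\vdash\mathrm{Created}(x)$, $Q\vdash\mathrm{Released}(x)$, $Q\vdash\mathrm{RecvCount}(x,n)$ mean $B\in\mathrm{dom}(Q)$ and $Q(B)$ derives the fact. $Q\vdash\mathrm{Chain}(x:A\to B)$ iff there are refobs $x_1:A_1\to B,\dots,x_n:A_n\to B$ with $Q\vdash\mathrm{Created}(x_1)$, $Q\not\vdash\mathrm{Released}(x_1)$, for all $i<n$ $Q\vdash\mathrm{CreatedUsing}(x_i,x_{i+1})$ and $Q\not\vdash\mathrm{Released}(x_{i+1})$, and $A_n=A$, $x_n=x$. $Q\vdash\mathrm{Relevant}(x)$ iff for some $n$, $Q\vdash\mathrm{Activated}(x)$, $Q\vdash\mathrm{SentCount}(x,n)$ and $Q\vdash\mathrm{RecvCount}(x,n)$. $Q$ is finalized if for all $B\in\mathrm{dom}(Q)$ and all refobs $x:A\to B$, $Q\vdash\mathrm{Chain}(x)$ implies $A\in\mathrm{dom}(Q)$ and $Q\vdash\mathrm{Relevant}(x)$. $B$ depends on $A$ in $Q$ if $A=B$ or there is a sequence of refobs $x_1:A_1\to A_2,\dots,x_{n-1}:A_{n-1}\to A_n$ ($n\ge2$) with $A_1=A$, $A_n=B$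 and $Q\vdash\mathrm{Chain}(x_i)$ for each $i<n$. An actor $C$ is finalized in $Q$ if for every $B$ on which $C$ depends in $Q$ and every refob $x:A\to B$, $Q\vdash\mathrm{Chain}(x)$ implies $Q\vdash\mathrm{Relevant}(x)$. $C$ is potentially finalized in $Q$ if for every such $B$ and $x:A\to B$, $Q\vdash\mathrm{Chain}(x)$ implies $Q\vdash\mathrm{Relevant}(x)$ or $A\notin\mathrm{dom}(Q)$. $B$ is a receptionist in $Q$ if $B\in\mathrm{dom}(Q)$ and there is a refob $x:A\to B$ with $Q\vdash\mathrm{Chain}(x)$ and $A\notin\mathrm{dom}(Q)$. The summary $\tilde Q$ of $Q$ is the least set of snapshots satisfying: (i) for every refob $x:A\to B$ with $A\in\mathrm{dom}(Q)$ and either $B$ a receptionist in $Q$ or $B\notin\mathrm{dom}(Q)$: if $Q(A)\vdash\mathrm{Activated}(x)$ then $\tilde Q(A)\vdash\mathrm{Activated}(x)$; if $Q(A)\vdash\mathrm{CreatedUsing}(x,y)$ then $\tilde Q(A)\vdash\mathrm{CreatedUsing}(x,y)$; if $Q(A)\vdash\mathrm{SentCount}(x,n)$ then $\tilde Q(A)\vdash\mathrm{SentCount}(x,n)$; (ii) for every refob $x:A\to B$ with $B$ a receptionist in $Q$: if $Q(B)\vdash\mathrm{Created}(x)$, $\mathrm{Released}(x)$, or $\mathrm{RecvCount}(x,n)$, then $\tilde Q(B)$ derives the same fact; (iii) if $A,B\in\mathrm{dom}(\tilde Q)$, $A$ is a receptionist in $Q$ and $B$ depends on $A$ in $Q$,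 then for a new (''fake'') refob $x:A\to B$ with a fresh token $x$, $\tilde Q(A)\vdash\mathrm{Activated}(x)$ and $\tilde Q(B)\vdash\mathrm{Created}(x)$.
   Formalization: Facts CreatedUsing(x,y) are restricted to refobs x, y with the same target actor; with arbitrary targets the claim fails, since a summary could derive Created(y) at a non-receptionist without its Released(y). *)

(* Defs.v *)
From HB Require Import structures.
From mathcomp Require Import all_boot finmap.

Set Implicit Arguments.
Unset Strict Implicit.
Unset Printing Implicit Defensive.

Local Open Scope fset_scope.
Local Open Scope fmap_scope.

(* [Refob x A B] is the refob  x : A -> B. *)
Record refob (token actor : choiceType) :=
  Refob { tok : token; owner : actor; target : actor }.

Section RefobChoice.
Variables token actor : choiceType.

Definition refob_encode (x : refob token actor) : token * actor * actor :=
  (tok x, owner x, target x).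

Definition refob_decode (p : token * actor * actor) : refob token actor :=
  Refob p.1.1 p.1.2 p.2.

Lemma refob_encodeK : cancel refob_encode refob_decode.
Proof. by case. Qed.

HB.instance Definition _ :=
  Choice.copy (refob token actor) (can_type refob_encodeK).

End RefobChoice.

(* CreatedUsing(x, y) says that the owner of x : A -> B used x to create a
   refob y : C -> B to the same actor; the shared target is part of the
   constructor's type. *)
Inductive fact (token actor : choiceType) :=
| Created of refob token actor
| Released of refob token actor
| CreatedUsing (x y : refob token actor) of target x == target y
| Activated of refob token actor
| Unreleased of refob token actor
| SentCount of refob token actor & nat
| RecvCount of refob token actor & nat.

Section FactChoice.
Variables token actor : choiceType.
Local Notation refob := (refob token actor).
Local Notation fact := (fact token actor).

Let using_pair := {p : refob * refob | target p.1 == target p.2}.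
Let code := (refob + refob + using_pair + refob + refob
             + refob * nat + refob * nat)%type.

Definition fact_encode (phi : fact) : code :=
  match phi with
  | Created x => inl (inl (inl (inl (inl (inl x)))))
  | Released x => inl (inl (inl (inl (inl (inr x)))))
  | CreatedUsing x y xy => inl (inl (inl (inl (inr (exist _ (x, y) xy)))))
  | Activated x => inl (inl (inl (inr x)))
  | Unreleased x => inl (inl (inr x))
  | SentCount x n => inl (inr (x, n))
  | RecvCount x n => inr (x, n)
  end.

Definition fact_decode (c : code) : fact :=
  match c with
  | inl (inl (inl (inl (inl (inl x))))) => Created x
  | inl (inl (inl (inl (inl (inr x))))) => Released x
  | inl (inl (inl (inl (inr p)))) => CreatedUsing (proj2_sig p)
  | inl (inl (inl (inr x))) => Activated x
  | inl (inl (inr x)) => Unreleased x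
  | inl (inr p) => SentCount p.1 p.2
  | inr p => RecvCount p.1 p.2
  end.

Lemma fact_encodeK : cancel fact_encode fact_decode.
Proof. by case. Qed.

HB.instance Definition _ := Choice.copy fact (can_type fact_encodeK).

End FactChoice.

Section Snapshots.
Variables token actor : choiceType.
Local Notation refob := (refob token actor).
Local Notation fact := (fact token actor).
Local Notation knowledge := {fset fact}.
Local Notation snapshots := {fmap actor -> knowledge}.

(* Facts are atoms and the three negation-as-failure rules conclude facts that
   are not premises of any rule, so derivability splits into a monotone part
   followed by at most one such rule. *)
Inductive derives_mono (Phi : knowledge) : fact -> Prop :=
| der_in phi : phi \in Phi -> derives_mono Phi phi
| der_using x y (xy : target x == target y) :
    derives_mono Phi (CreatedUsing xy) -> derives_mono Phi (Created y).

Inductive derives (Phi : knowledge) : fact -> Prop :=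
| der_mono phi : derives_mono Phi phi -> derives Phi phi
| der_sent0 x : (forall n, SentCount x n \notin Phi) ->
    derives Phi (SentCount x 0)
| der_recv0 x : (forall n, RecvCount x n \notin Phi) ->
    derives Phi (RecvCount x 0)
| der_unreleased x : derives_mono Phi (Created x) ->
    ~ derives_mono Phi (Released x) -> derives Phi (Unreleased x).

(* The knowledge Q(A); an actor without a snapshot knows no fact. *)
Definition know (Q : snapshots) (A : actor) : knowledge :=
  odflt fset0 Q.[? A].

(* The actor in whose snapshot a fact is looked up. *)
Definition holder (phi : fact) : actor :=
  match phi with
  | Activated x | SentCount x _ => owner x
  | CreatedUsing x _ _ => owner x
  | Created x | Released x | Unreleased x | RecvCount x _ => target x
  end.

Definition holds (Q : snapshots) (phi : fact) : Prop :=
  holder phi \in domf Q /\ derives (know Q (holder phi)) phi.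

(* The sequence x_1, ..., x_n grows at its end; its members share their
   target by the typing of CreatedUsing. *)
Inductive chain (Q : snapshots) : refob -> Prop :=
| chain_start x : holds Q (Created x) -> ~ holds Q (Released x) -> chain Q x
| chain_next x y (xy : target x == target y) :
    chain Q x -> holds Q (CreatedUsing xy) -> ~ holds Q (Released y) ->
    chain Q y.

Definition relevant (Q : snapshots) (x : refob) : Prop :=
  exists n, [/\ holds Q (Activated x), holds Q (SentCount x n)
              & holds Q (RecvCount x n)].

Definition finalized (Q : snapshots) : Prop :=
  forall x, target x \in domf Q -> chain Q x ->
    owner x \in domf Q /\ relevant Q x.

(* [reaches Q A B]: A = B, or there are refobs x_1 : A -> A_2, ...,
   x_(n-1) : A_(n-1) -> B that all satisfy Chain. *)
Inductive reaches (Q : snapshots) (A : actor) : actor -> Prop :=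
| reaches_refl : reaches Q A A
| reaches_step x : reaches Q A (owner x) -> chain Q x ->
    reaches Q A (target x).

Definition depends_on (Q : snapshots) (B A : actor) : Prop := reaches Q A B.

Definition actor_finalized (Q : snapshots) (C : actor) : Prop :=
  forall x, depends_on Q C (target x) -> chain Q x -> relevant Q x.

Definition potentially_finalized (Q : snapshots) (C : actor) : Prop :=
  forall x, depends_on Q C (target x) -> chain Q x ->
    relevant Q x \/ owner x \notin domf Q.

Definition receptionist (Q : snapshots) (B : actor) : Prop :=
  B \in domf Q /\
  exists x, [/\ target x = B, chain Q x & owner x \notin domf Q].

(* The pairs (A, B) for which the summary R of Q has a fake refob. *)
Definition fake_pair (Q R : snapshots) (A B : actor) : Prop :=
  [/\ A \in domf R, B \in domf R, receptionist Q A & depends_on Q B A].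

(* The closure conditions of a summary; [fresh A B] is the token of the fake
   refob from A to B. *)
Record summary_conditions (fresh : actor -> actor -> token)
    (Q R : snapshots) : Prop := SummaryConditions {
  summary_owner : forall x, owner x \in domf Q ->
    receptionist Q (target x) \/ target x \notin domf Q ->
    [/\ derives (know Q (owner x)) (Activated x) ->
          derives (know R (owner x)) (Activated x),
        forall y (xy : target x == target y),
          derives (know Q (owner x)) (CreatedUsing xy) ->
          derives (know R (owner x)) (CreatedUsing xy)
      & forall n, derives (know Q (owner x)) (SentCount x n) ->
          derives (know R (owner x)) (SentCount x n)];
  summary_target : forall x, receptionist Q (target x) ->
    [/\ derives (know Q (target x)) (Created x) ->
          derives (know R (target x)) (Created x),
        derives (know Q (target x)) (Released x) ->
          derives (know R (target x)) (Released x)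
      & forall n, derives (know Q (target x)) (RecvCount x n) ->
          derives (know R (target x)) (RecvCount x n)];
  summary_fake : forall A B, fake_pair Q R A B ->
    derives (know R A) (Activated (Refob (fresh A B) A B)) /\
    derives (know R B) (Created (Refob (fresh A B) A B))
}.

(* Facts obtained by negation as failure are not counted, since they are lost
   rather than gained when a knowledge set grows; with them no least set of
   snapshots would exist. *)
Definition sub_snapshots (R R' : snapshots) : Prop :=
  domf R `<=` domf R' /\
  forall A phi, derives_mono (know R A) phi -> derives_mono (know R' A) phi.

Definition is_summary (fresh : actor -> actor -> token)
    (Q R : snapshots) : Prop :=
  summary_conditions fresh Q R /\
  forall R', summary_conditions fresh Q R' -> sub_snapshots R R'.

Definition fact_tokens (phi : fact) : seq token :=
  match phi with
  | Created x | Released x | Activated x | Unreleased x => [:: tok x]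
  | SentCount x _ | RecvCount x _ => [:: tok x]
  | CreatedUsing x y _ => [:: tok x; tok y]
  end.

Definition occurs (t : token) (Q : snapshots) : Prop :=
  exists A phi, phi \in know Q A /\ t \in fact_tokens phi.

End Snapshots.

(* Main.v *)
(** Minimality forces the facts of a summary to be exactly the facts of the
    original snapshots about refobs to receptionists or to outside actors,
    together with the facts about fake refobs. Hence a refob to a receptionist
    is on a chain, or relevant, in the union of the summaries iff it is so in
    the union of the originals. A chain to a non-receptionist stays inside one
    of the two sets, where potential finalization makes it relevant. A path of
    the original union therefore consists of refobs to receptionists, which the
    summaries keep, and of segments inside one set, which a fake refob
    replaces; conversely a fake refob stands for such a segment. *)

Require Import Defs.
From mathcomp Require Import all_boot finmap.
From mathcomp Require Import boolp.

Set Implicit Arguments.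
Unset Strict Implicit.
Unset Printing Implicit Defensive.

Local Open Scope fset_scope.
Local Open Scope fmap_scope.

(** * Derivability, chains and reachability *)

Section Derivability.
Variables token actor : choiceType.
Local Notation refob := (refob token actor).
Local Notation fact := (fact token actor).
Local Notation knowledge := {fset fact}.
Local Notation snapshots := {fmap actor -> knowledge}.
Implicit Types (x y : refob) (phi : fact) (Phi Psi : knowledge) (Q : snapshots).

Definition fact_target phi : actor :=
  match phi with
  | Created x | Released x | CreatedUsing x _ _ | Activated x
  | Unreleased x | SentCount x _ | RecvCount x _ => target x
  end.

(** Facts whose derivability involves no negation as failure. *)
Definition positive phi : bool :=
  match phi with
  | Unreleased _ | SentCount _ _ | RecvCount _ _ => false
  | _ => true
  end.

Definition unreleased phi : bool :=
  if phi is Unreleased _ then true else false.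

(** No rule concludes [CreatedUsing], so the rule for it is applied at most once. *)
Lemma derives_monoP Phi phi : derives_mono Phi phi <->
  phi \in Phi \/
  exists x y (xy : target x == target y),
    CreatedUsing xy \in Phi /\ phi = Created y.
Proof.
split=> [[psi ?|x y xy H]|[?|[x [y [xy [H ->]]]]]]; first by left.
- right; exists x, y, xy; split=> //.
  by inversion_clear H.
- exact: der_in.
- exact: (der_using (der_in H)).
Qed.

Lemma derives_mono_in Phi phi :
  derives_mono Phi phi ->
  (if phi is Created _ then false else true) -> phi \in Phi.
Proof. by move=> /[swap] np /derives_monoP[//|[x [y [xy [_ E]]]]]; rewrite E in np. Qed.

Lemma derives_cases Phi phi : derives Phi phi ->
  derives_mono Phi phi \/
  match phi with
  | SentCount x n => n = 0 /\ forall m, SentCount x m \notin Phi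
  | RecvCount x n => n = 0 /\ forall m, RecvCount x m \notin Phi
  | Unreleased _ => True
  | _ => False
  end.
Proof. by case=> *; [left|right|right|right]. Qed.

Lemma derives_positive Phi phi :
  positive phi -> derives Phi phi <-> derives_mono Phi phi.
Proof.
by move=> p; split; [case/derives_cases=> //; case: phi p | exact: der_mono].
Qed.

Lemma derives_sentP Phi x n : derives Phi (SentCount x n) <->
  SentCount x n \in Phi \/ n = 0 /\ forall m, SentCount x m \notin Phi.
Proof.
split=> [/derives_cases[/derives_mono_in|]|[H|[-> H]]]; [by left; auto|by right| |].
- exact/der_mono/der_in.
- exact: der_sent0.
Qed.

Lemma derives_recvP Phi x n : derives Phi (RecvCount x n) <->
  RecvCount x n \in Phi \/ n = 0 /\ forall m, RecvCount x m \notin Phi.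
Proof.
split=> [/derives_cases[/derives_mono_in|]|[H|[-> H]]]; [by left; auto|by right| |].
- exact/der_mono/der_in.
- exact: der_recv0.
Qed.

Lemma derives_mono_dom Q A phi : derives_mono (know Q A) phi -> A \in domf Q.
Proof.
rewrite /know; case: fndP => // _ /derives_monoP[|[? [? [? []]]]] //.
Qed.

Lemma chain_dom Q x : chain Q x -> target x \in domf Q.
Proof. by elim=> [y [] //|y z /eqP yz _ + _ _]; rewrite yz. Qed.

Lemma reaches_dom Q A B : A \in domf Q -> reaches Q A B -> B \in domf Q.
Proof. by move=> AQ; case=> // x _ /chain_dom. Qed.

Lemma reaches_chainl Q x B : chain Q x -> reaches Q (target x) B ->
  reaches Q (owner x) B.
Proof.
move=> cx; elim=> [|y _ IH cy]; last exact: reaches_step.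
exact: reaches_step (reaches_refl _ _) cx.
Qed.

(** [reaches] grows at its target end; this induction walks a path back from its end [B] to its
    source. *)
Lemma reaches_ind_left Q (P : actor -> Prop) A B :
  (forall x, chain Q x -> P (target x) -> P (owner x)) ->
  reaches Q A B -> P B -> P A.
Proof. by move=> step; elim=> // x _ IH cx /(step _ cx). Qed.

End Derivability.

(** * Cutting snapshots down to a class of facts *)

Section Restriction.
Variables token actor : choiceType.
Local Notation fact := (fact token actor).
Local Notation snapshots := {fmap actor -> {fset fact}}.
Implicit Types (phi : fact) (R : snapshots) (P : actor -> fact -> Prop).

Definition weaken phi : fact :=
  if phi is CreatedUsing _ y _ then Created y else phi.

Definition consequences (Phi : {fset fact}) : {fset fact} :=
  Phi `|` [fset weaken phi | phi in Phi].

Lemma in_consequences (Phi : {fset fact}) phi :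
  phi \in consequences Phi <-> derives_mono Phi phi.
Proof.
rewrite derives_monoP in_fsetU; split.
  case/orP=> [|/imfsetP[psi /= psiPhi ->]]; first by left.
  by case: psi psiPhi => /=; auto=> x y xy ?; right; exists x, y, xy.
case=> [->//|[x [y [xy [H ->]]]]]; apply/orP; right.
by apply/imfsetP; exists (CreatedUsing xy).
Qed.

(* Dropping a fact [CreatedUsing x y] must not lose the [Created y] that it
   entails, hence the restriction of the deductive closure. *)
Definition restricted_know P R A : {fset fact} :=
  [fset phi in consequences (know R A) | `[<P A phi>]].

(** Actors left without facts leave the domain too, so that minimality of a summary will bound its
    domain as well as its facts. *)
Definition restrict_facts P R : snapshots :=
  [fmap A : [fset A in domf R | restricted_know P R A != fset0] =>
     restricted_know P R (val A)].

Lemma in_restricted_know P R A phi :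
  phi \in restricted_know P R A <-> derives_mono (know R A) phi /\ P A phi.
Proof.
rewrite !inE -in_fsetU -in_consequences.
by split=> [/andP[-> /asboolP]|[-> /asboolP]].
Qed.

Lemma in_know_restrict P R A phi :
  phi \in know (restrict_facts P R) A <->
  derives_mono (know R A) phi /\ P A phi.
Proof.
rewrite -in_restricted_know; rewrite [know _ A]/know.
case: fndP => /= [AR|nA]; first by rewrite ffunE.
move: nA; rewrite in_fset /= inE /= negb_and negbK => /orP[AR|/eqP->//].
split=> // /in_restricted_know[/derives_mono_dom]; by rewrite (negPf AR).
Qed.

Lemma in_dom_restrict P R A : A \in domf (restrict_facts P R) ->
  A \in domf R /\ exists phi, phi \in know (restrict_facts P R) A.
Proof.
rewrite /= !inE => /andP[AR /fset0Pn[phi phiK]]; split=> //.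
by exists phi; apply/in_know_restrict/in_restricted_know.
Qed.

End Restriction.

(** * The exact content of a summary *)

Section Summary.
Variables token actor : choiceType.
Local Notation refob := (refob token actor).
Local Notation fact := (fact token actor).
Local Notation snapshots := {fmap actor -> {fset fact}}.
Variables (fresh : actor -> actor -> token) (Q R : snapshots).

Definition exportable (phi : fact) : Prop :=
  receptionist Q (fact_target phi) \/ fact_target phi \notin domf Q.

Definition exported (A : actor) (phi : fact) : Prop :=
  [/\ holder phi = A, A \in domf Q, exportable phi
    & derives_mono (know Q A) phi].

Definition fake_refob (x : refob) : Prop :=
  fake_pair Q R (owner x) (target x) /\ tok x = fresh (owner x) (target x).

Definition fake_fact (phi : fact) : Prop :=
  match phi with
  | Activated x | Created x => fake_refob x
  | _ => False
  end.

Definition required (A : actor) (phi : fact) : Prop :=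
  exported A phi \/ holder phi = A /\ fake_fact phi.

Hypothesis summary : is_summary fresh Q R.

Let conditions : summary_conditions fresh Q R := summary.1.

Lemma required_dom A phi : required A phi -> A \in domf Q.
Proof.
case=> [[]//|[<-]]; case: phi => //= x [[_ _ [oQ _] dep] _] //.
exact: reaches_dom dep.
Qed.

Lemma exportable_target (phi : fact) :
  exportable phi -> fact_target phi \in domf Q ->
  receptionist Q (fact_target phi).
Proof. by case=> // /negPf->. Qed.

Lemma summary_derives phi : holder phi \in domf Q -> exportable phi ->
  ~~ unreleased phi -> derives (know Q (holder phi)) phi ->
  derives (know R (holder phi)) phi.
Proof.
case: phi => //= [x|x|x y xy|x|x n|x n] HQ ex _ H.
- by have [+ _ _] := summary_target conditions (exportable_target ex HQ); apply.
- by have [_ + _] := summary_target conditions (exportable_target ex HQ); apply.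
- by have [_ + _] := summary_owner conditions HQ ex; apply.
- by have [+ _ _] := summary_owner conditions HQ ex; apply.
- by have [_ _ +] := summary_owner conditions HQ ex; apply.
- by have [_ _ +] := summary_target conditions (exportable_target ex HQ); apply.
Qed.

(** The competitor for minimality: [R] without the facts that no closure condition asks for. *)
Let R' := restrict_facts required R.

Lemma restrict_fake_pair A B : fake_pair Q R' A B -> fake_pair Q R A B.
Proof. by case=> /in_dom_restrict[AR _] /in_dom_restrict[BR _]. Qed.

(** Positive facts survive because they are required. A count may be stored or hold by default, in
    [Q] and in [R] independently, hence the four cases. *)
Lemma restrict_derives phi : holder phi \in domf Q -> exportable phi ->
  ~~ unreleased phi -> derives (know Q (holder phi)) phi ->
  derives (know R' (holder phi)) phi.
Proof.
move=> HQ ex nu Hq; have Hr := summary_derives HQ ex nu Hq.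
have [pos|npos] := boolP (positive phi).
  apply/derives_positive/der_in/in_know_restrict => //.
  by split; last (left; split=> //); apply/derives_positive.
case: phi npos nu HQ ex Hq Hr => //= x n _ _ HQ ex.
- move=> /derives_sentP[Hq|[-> Hq]] /derives_sentP[Hr|[n0 Hr]].
  + apply/derives_sentP; left; apply/in_know_restrict.
    by split; last (left; split=> //); apply: der_in.
  + rewrite n0; apply/der_sent0=> m; apply/negP=> /in_know_restrict[].
    by move/derives_mono_in=> /(_ isT); rewrite (negPf (Hr _)).
  (* [R] stores 0 where [Q] stores nothing: no send count of [x] is required, so [R'] stores none
     and has the default 0. *)
  + apply/der_sent0=> m; apply/negP=> /in_know_restrict[_ []].
      by case=> _ _ _ /derives_mono_in => /(_ isT); rewrite (negPf (Hq _)).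
    by case.
  + apply/der_sent0=> m; apply/negP=> /in_know_restrict[].
    by move/derives_mono_in=> /(_ isT); rewrite (negPf (Hr _)).
- move=> /derives_recvP[Hq|[-> Hq]] /derives_recvP[Hr|[n0 Hr]].
  + apply/derives_recvP; left; apply/in_know_restrict.
    by split; last (left; split=> //); apply: der_in.
  + rewrite n0; apply/der_recv0=> m; apply/negP=> /in_know_restrict[].
    by move/derives_mono_in=> /(_ isT); rewrite (negPf (Hr _)).
  + apply/der_recv0=> m; apply/negP=> /in_know_restrict[_ []].
      by case=> _ _ _ /derives_mono_in => /(_ isT); rewrite (negPf (Hq _)).
    by case.
  + apply/der_recv0=> m; apply/negP=> /in_know_restrict[].
    by move/derives_mono_in=> /(_ isT); rewrite (negPf (Hr _)).
Qed.

Lemma restrict_conditions : summary_conditions fresh Q R'.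
Proof.
split.
- move=> x HQ ex; split=> [|y xy|n].
  + exact: (@restrict_derives (Activated x)).
  + exact: (@restrict_derives (CreatedUsing xy)).
  + exact: (@restrict_derives (SentCount x n)).
- move=> x rec; have [HQ _] := rec; split=> [| |n].
  + by apply: (@restrict_derives (Created x)) => //; left.
  + by apply: (@restrict_derives (Released x)) => //; left.
  + by apply: (@restrict_derives (RecvCount x n)) => //; left.
- move=> A B /restrict_fake_pair fAB.
  have [HA HB] := summary_fake conditions fAB.
  split; apply/derives_positive/der_in/in_know_restrict => //.
  + by split; [apply/derives_positive | right].
  + by split; [apply/derives_positive | right].
Qed.

(** Minimality places [R] below [R'], whose stored facts are required. A [Created y] that is only
    derived comes from a stored [CreatedUsing x y]; [Q] derives that fact too and the target is
    shared, so the same rule applies in [Q]. *)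
Lemma summary_required A phi : derives_mono (know R A) phi -> holder phi = A ->
  required A phi.
Proof.
have [_ sub] := summary.2 _ restrict_conditions.
move=> /sub /derives_monoP[/in_know_restrict[_ //]|[x [y [xy [+ ->]]]]].
move=> /in_know_restrict[_ [[/= <- HQ ex H] yA|[_ []]]]; left.
have xt : target y = target x by rewrite (eqP xy).
split=> //; first by rewrite /exportable /= xt.
exact: der_using H.
Qed.

Lemma summary_dom A : A \in domf R -> A \in domf Q.
Proof.
have [/fsubsetP sub _] := summary.2 _ restrict_conditions.
by move=> /sub /in_dom_restrict[_ [phi /in_know_restrict[_ /required_dom]]].
Qed.

Lemma summary_derivesE phi : holder phi \in domf Q -> exportable phi ->
  ~~ unreleased phi -> ~ fake_fact phi ->
  derives (know Q (holder phi)) phi <-> derives (know R (holder phi)) phi.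
Proof.
move=> HQ ex nu nf; split; first exact: summary_derives.
have mono psi : holder psi = holder phi -> ~ fake_fact psi ->
    derives_mono (know R (holder phi)) psi ->
    derives_mono (know Q (holder phi)) psi.
  by move=> hpsi npsi /summary_required[//|[]|[]].
have [pos|npos] := boolP (positive phi).
  by move=> /derives_positive Hr; apply/derives_positive/mono => //; apply: Hr.
case: phi npos nu HQ ex nf mono => //= x n _ _ HQ ex _ mono.
- move=> /derives_sentP[/der_in/mono|[-> Hr]]; first by move=> H; apply/der_mono/H.
  (* If [Q] stores a count [m], then [R] derives it while storing none, so [m] is the default 0. *)
  have [[m Hm]|none] := pselect (exists m, SentCount x m \in know Q (owner x)).
    have := @summary_derives (SentCount x m) HQ ex isT (der_mono (der_in Hm)).
    case/derives_sentP=> [/= Hrm|[m0 _]].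
      by rewrite (negPf (Hr m)) in Hrm.
    by apply/der_mono/der_in; rewrite -m0.
  by apply: der_sent0 => m; apply/negP=> Hm; apply: none; exists m.
- move=> /derives_recvP[/der_in/mono|[-> Hr]]; first by move=> H; apply/der_mono/H.
  have [[m Hm]|none] := pselect (exists m, RecvCount x m \in know Q (target x)).
    have := @summary_derives (RecvCount x m) HQ ex isT (der_mono (der_in Hm)).
    case/derives_recvP=> [/= Hrm|[m0 _]].
      by rewrite (negPf (Hr m)) in Hrm.
    by apply/der_mono/der_in; rewrite -m0.
  by apply: der_recv0 => m; apply/negP=> Hm; apply: none; exists m.
Qed.

End Summary.

(** * Unions of two sets of snapshots and of their summaries *)

Section Union.
Variables token actor : choiceType.
Local Notation refob := (refob token actor).
Local Notation fact := (fact token actor).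
Local Notation snapshots := {fmap actor -> {fset fact}}.

(** Indexing the two sets by [bool] treats them symmetrically, so each argument is given once for an
    arbitrary index. *)
Definition is_union (Q : bool -> snapshots) (U : snapshots) : Prop :=
  (forall A, A \in domf U <-> exists b, A \in domf (Q b)) /\
  (forall b A, A \in domf (Q b) -> know U A = know (Q b) A).

Lemma holds_union Q U phi : is_union Q U ->
  holds U phi <-> exists b, holds (Q b) phi.
Proof.
move=> [dom kn]; split=> [[/dom[b Hb] H]|[b [Hb H]]].
  by exists b; split=> //; rewrite -(kn b).
by split; [apply/dom; exists b | rewrite (kn b)].
Qed.

Lemma is_union_cat (Q1 Q2 : snapshots) : [disjoint domf Q1 & domf Q2] ->
  is_union (fun b => if b then Q1 else Q2) (Q1 + Q2).
Proof.
move=> dis; split=> [A|[] A HA].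
- rewrite mem_catf; split=> [/orP[]|[[] ->]]; rewrite ?orbT //.
    by exists true.
  by exists false.
- by rewrite /know fnd_cat (negPf (fdisjointP dis _ HA)).
- by rewrite /know fnd_cat HA.
Qed.

Variables (fresh : bool -> actor -> actor -> token) (Q R : bool -> snapshots).
Variables U V : snapshots.
Hypothesis QU : is_union Q U.
Hypothesis RV : is_union R V.
Hypothesis disjoint_dom : forall A b c,
  A \in domf (Q b) -> A \in domf (Q c) -> b = c.
Hypothesis summary : forall b, is_summary (fresh b) (Q b) (R b).
Hypothesis freshP : forall b c A B,
  fake_pair (Q b) (R b) A B -> ~ occurs (fresh b A B) (Q c).
Hypothesis pot_finalized : forall b A,
  A \in domf (Q b) -> potentially_finalized (Q b) A.

Definition fake (x : refob) : Prop :=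
  exists b, fake_refob (fresh b) (Q b) (R b) x.

Lemma holdsQ b phi : holder phi \in domf (Q b) ->
  holds U phi <-> holds (Q b) phi.
Proof.
move=> Hb; split=> [|H]; last by apply/(holds_union _ QU); exists b.
move=> /(holds_union _ QU)[c Hc].
by rewrite (disjoint_dom Hb (proj1 Hc)).
Qed.

Lemma holdsQ_sub b phi : holds (Q b) phi -> holds U phi.
Proof. by move=> H; apply/(holds_union _ QU); exists b. Qed.

(** A receptionist of one set lies outside the domain of the other, so both summaries keep the facts
    about refobs to it. *)
Lemma exportable_receptionist b c phi :
  receptionist (Q b) (fact_target phi) -> exportable (Q c) phi.
Proof.
move=> rec; have [<-|bc] := eqVneq b c; first by left.
right; apply/negP=> Hc; case/eqP: bc; exact: disjoint_dom (proj1 rec) Hc.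
Qed.

(** A positive fact puts its holder into the domain of the summary. A default count does not, being
    derivable from empty knowledge; hence the side condition on the holder. *)
Lemma holds_summary b phi : receptionist (Q b) (fact_target phi) ->
  ~~ unreleased phi -> positive phi || (holder phi \in domf V) ->
  holds U phi -> holds V phi.
Proof.
move=> rec nu pos /(holds_union _ QU)[c [Hc H]].
have ex := exportable_receptionist c rec.
have Hr := summary_derives (summary c) Hc ex nu H.
apply/(holds_union _ RV); exists c; split=> //.
case/orP: pos => [pos|/RV.1[d Hd]].
  by move/(derives_positive _ pos): Hr => /derives_mono_dom.
by rewrite (disjoint_dom Hc (summary_dom (summary d) Hd)).
Qed.

Lemma holds_of_summary b phi : receptionist (Q b) (fact_target phi) ->
  ~~ unreleased phi -> (forall c, ~ fake_fact (fresh c) (Q c) (R c) phi) ->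
  holds V phi -> holds U phi.
Proof.
move=> rec nu nf /(holds_union _ RV)[c [Hc H]].
have ex := exportable_receptionist c rec.
have HQ := summary_dom (summary c) Hc.
apply: (@holdsQ_sub c); split=> //.
exact/(summary_derivesE (summary c) HQ ex nu (@nf c)).
Qed.

Lemma fake_unknown x : fake x -> forall c A phi,
  phi \in know (Q c) A -> tok x \notin fact_tokens phi.
Proof.
move=> [b [fp ->]] c A phi Hphi; apply/negP=> Ht.
by apply: (freshP fp (c := c)); exists A, phi.
Qed.

Lemma holds_in phi :
  (if phi is Created _ then false else positive phi) ->
  holds U phi -> exists c, phi \in know (Q c) (holder phi).
Proof.
move=> H /(holds_union _ QU)[c [_ Hc]]; exists c.
apply: derives_mono_in; last by case: (phi) H.
by move/derives_positive: Hc; apply; case: (phi) H.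
Qed.

(** The last refob of a chain occurs in a stored fact of some [Q c], while the token of a fake refob
    occurs in none. *)
Lemma chain_real x : chain U x -> ~ fake x.
Proof.
case=> [y /(holds_union _ QU)[c [_ Hc]] _|z y zy _ H _] /fake_unknown fy.
  move/derives_positive: Hc => /(_ isT) /derives_monoP.
  case=> [/fy|[z [w [zw [/fy + [E]]]]]]; rewrite /= ?E !inE eqxx //.
  by rewrite orbT.
have [c /fy] := holds_in (phi := CreatedUsing zy) isT H.
by rewrite /= !inE eqxx orbT.
Qed.

(** * Chains of one set and chains of the union *)

Lemma chain_union b x : chain (Q b) x -> chain U x.
Proof.
elim=> [y H nH|y z yz cy IH H nH].
  apply: chain_start; first exact: holdsQ_sub H.
  (* [Released y] is looked up at [target y], an actor of [Q b], so the other set cannot contribute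
     it. *)
  by move/(@holdsQ b (Released y) (proj1 H)).
apply: (chain_next IH (holdsQ_sub H)).
have tz : holder (Released z) \in domf (Q b).
  by rewrite /= -(eqP yz); apply: chain_dom cy.
by move/(holdsQ tz).
Qed.

Lemma reaches_union b A B : reaches (Q b) A B -> reaches U A B.
Proof.
elim=> [|x _ IH /chain_union cx]; first exact: reaches_refl.
exact: reaches_step.
Qed.

(** All refobs of the chain share a non-receptionist target, so a prefix that is a chain of [Q b]
    has its last owner in [Q b]; the next [CreatedUsing] is then known inside [Q b] as well. *)
Lemma chain_local b x : chain U x -> target x \in domf (Q b) ->
  ~ receptionist (Q b) (target x) -> chain (Q b) x /\ owner x \in domf (Q b).
Proof.
have own y : chain (Q b) y -> target y \in domf (Q b) ->
    ~ receptionist (Q b) (target y) -> owner y \in domf (Q b).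
  move=> cy ty nrec; apply/negPn/negP=> oy; apply: nrec.
  by split=> //; exists y.
move=> cx tx nrec; suff cb : chain (Q b) x by split=> //; apply: own.
elim: cx tx nrec => {x} [x H nH|y z yz _ IH H nH] tx nrec.
  apply: chain_start; first exact/(@holdsQ b (Created x)).
  by move/(@holdsQ b (Released x) tx).
have E := eqP yz; rewrite -E in tx nrec.
have cy := IH tx nrec.
apply: (chain_next cy).
  exact/(@holdsQ b (CreatedUsing yz) (own _ cy tx nrec)).
by rewrite E in tx; move/(@holdsQ b (Released z) tx).
Qed.

Lemma relevant_local b x : chain U x -> target x \in domf (Q b) ->
  ~ receptionist (Q b) (target x) -> relevant U x.
Proof.
move=> cx tx nrec; have [cb ox] := chain_local cx tx nrec.
(* The target depends on itself, so its own potential finalization applies; [ox] excludes the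
   alternative of an outside owner. *)
have [[n [H1 H2 H3]]|] := pot_finalized tx (reaches_refl _ _) cb.
  by exists n; split; apply: holdsQ_sub; eassumption.
by rewrite ox.
Qed.

(** * Chains and relevance in the union of the summaries *)

Lemma chain_summary b x : chain U x -> receptionist (Q b) (target x) ->
  chain V x.
Proof.
elim=> {x} [x H nH|y z yz _ IH H nH] rec.
  apply: chain_start; first exact: (holds_summary (phi := Created x) rec) H.
  by move/(holds_of_summary (phi := Released x) rec isT (fun _ => id)).
have rec' : receptionist (Q b) (target y) by rewrite (eqP yz).
apply: (chain_next (IH rec')).
  exact: (holds_summary (phi := CreatedUsing yz) rec') H.
by move/(holds_of_summary (phi := Released z) rec isT (fun _ => id)).
Qed.

(** The fake refob alone is a chain: a [Released] fact of a summary comes from the originals, where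
    the token does not occur. *)
Lemma fake_chain b x : fake_refob (fresh b) (Q b) (R b) x -> chain V x.
Proof.
move=> fx; have [fp Ht] := fx; have [oR tR rec dep] := fp.
have [_] := summary_fake (summary b).1 fp; rewrite -Ht => HC.
have E : Refob (tok x) (owner x) (target x) = x by case: (x).
rewrite E in HC; apply: chain_start.
  by apply/(holds_union _ RV); exists b.
move=> /(holds_union _ RV)[c [Hc /derives_positive]] => /(_ isT).
move=> /(summary_required (summary c)) /(_ erefl)[[_ _ _]|[_ []]].
move=> /derives_mono_in /(_ isT) /(fake_unknown (ex_intro _ b fx)).
by rewrite /= inE eqxx.
Qed.

Lemma fake_relevant x : fake x -> relevant V x.
Proof.
move=> fx; have [b [fp Ht]] := fx; have [oR tR rec dep] := fp.
have [] := summary_fake (summary b).1 fp; rewrite -Ht => HA _.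
have E : Refob (tok x) (owner x) (target x) = x by case: (x).
rewrite E in HA.
(* No count with the fresh token is stored, so both counts are 0 by default. *)
exists 0; split; apply/(holds_union _ RV); exists b; split=> //.
- apply: der_sent0 => n; apply/negP=> /der_in.
  move=> /(summary_required (summary b)) /(_ erefl)[[_ _ _]|[_ []]].
  by move=> /derives_mono_in /(_ isT) /(fake_unknown fx); rewrite /= inE eqxx.
- apply: der_recv0 => n; apply/negP=> /der_in.
  move=> /(summary_required (summary b)) /(_ erefl)[[_ _ _]|[_ []]].
  by move=> /derives_mono_in /(_ isT) /(fake_unknown fx); rewrite /= inE eqxx.
Qed.

(** A fake refob is never extended, since a [CreatedUsing] fact of a summary comes from the
    originals, which mention no fake token. The [Created] fact of a real start is held by its
    target, and is exported only if that target is a receptionist. *)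
Lemma chain_of_summary x : chain V x -> fake x \/
  chain U x /\ exists b, receptionist (Q b) (target x).
Proof.
elim=> {x} [x H nH|y z yz _ IH H nH].
  case/(holds_union _ RV): (H) => c [Hc /derives_positive] => /(_ isT).
  move=> /(summary_required (summary c)) /(_ erefl)[[_ HQ ex Hd]|[_ f]]; last first.
    by left; exists c.
  have rec := exportable_target ex HQ.
  right; split; last by exists c.
  apply: chain_start; first by apply: (@holdsQ_sub c); split=> //; apply: der_mono.
  by move/(holds_summary (phi := Released x) rec isT isT).
case/(holds_union _ RV): (H) => c [Hc /derives_positive] => /(_ isT).
move=> /(summary_required (summary c)) /(_ erefl)[[_ HQ ex Hd]|[_ []]].
case: IH => [/fake_unknown fy|[cy [b rec]]].
  move/derives_mono_in: Hd => /(_ isT) /fy.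
  by rewrite /= !inE eqxx.
right; rewrite -(eqP yz); split; last by exists b.
apply: (chain_next cy); first by apply: (@holdsQ_sub c); split=> //; apply: der_mono.
have rec' : receptionist (Q b) (target z) by rewrite -(eqP yz).
by move/(holds_summary (phi := Released z) rec' isT isT).
Qed.

Lemma relevant_summary b x : chain U x -> receptionist (Q b) (target x) ->
  relevant U x <-> relevant V x.
Proof.
move=> cx rec; have nf := chain_real cx.
(* A receive count may hold by default, so its holder must be known to lie in the domain of [V]; for
   the send count [Activated] ensures this. *)
have tV : target x \in domf V by apply: chain_dom (chain_summary cx rec).
split=> -[n [H1 H2 H3]]; exists n.
- have HA := holds_summary (phi := Activated x) rec isT isT H1.
  split=> //.
    by apply: (holds_summary (phi := SentCount x n) rec) H2 => //=; apply: HA.1.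
  exact: (holds_summary (phi := RecvCount x n) rec) H3.
- split.
  + apply: (holds_of_summary (phi := Activated x) rec) H1 => // c f.
    by apply: nf; exists c.
  + exact: (holds_of_summary (phi := SentCount x n) rec isT (fun _ => id)) H2.
  + exact: (holds_of_summary (phi := RecvCount x n) rec isT (fun _ => id)) H3.
Qed.

(** * Paths and finalization in the two unions *)

Lemma reaches_of_summary A B : reaches V A B -> reaches U A B.
Proof.
elim=> [|x _ IH /chain_of_summary[[b [[_ _ _ dep] _]]|[cx _]]].
- exact: reaches_refl.
(* The fake refob records a dependency in [Q b]; the path behind it is spliced in. *)
- move/reaches_union: dep; elim: (target x) / => [//|y _ IHy cy].
  exact: reaches_step IHy cy.
- exact: reaches_step IH cx.
Qed.

(** One fake refob stands for the whole path inside [Q b]. *)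
Lemma fake_step b A B C : A \in domf (R b) -> B \in domf (R b) ->
  receptionist (Q b) A -> reaches (Q b) A B -> reaches V B C -> reaches V A C.
Proof.
move=> AR BR rec dep BC.
pose x := Refob (fresh b A B) A B.
have cx : chain V x by apply: (@fake_chain b).
exact: reaches_chainl cx BC.
Qed.

Lemma receptionist_summary b x : chain U x -> receptionist (Q b) (target x) ->
  target x \in domf (R b).
Proof.
move=> cx rec; have /RV.1[c Hc] := chain_dom (chain_summary cx rec).
by rewrite (disjoint_dom rec.1 (summary_dom (summary c) Hc)).
Qed.

(* [G] is the first actor on the path from [E] to [C] that the summaries
   keep; the part of the path before [G] stays inside one [Q b]. *)
Lemma reaches_summary C E : C \in domf V -> actor_finalized V C ->
  reaches U E C -> exists b G,
  [/\ E \in domf (Q b), G \in domf (R b), reaches (Q b) E G & reaches V G C].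
Proof.
move=> /RV.1[c CR] fin EC; have CQ := summary_dom (summary c) CR.
pattern E; apply: (reaches_ind_left _ EC); last first.
  by exists c, C; split=> //; apply: reaches_refl.
move=> x cx [b [G [tQ GR dep GC]]].
have [rec|nrec] := pselect (receptionist (Q b) (target x)); last first.
  (* A refob to a non-receptionist stays in [Q b] and lengthens the inner segment. *)
  have [cb oQ] := chain_local cx tQ nrec.
  by exists b, G; split=> //; apply: reaches_chainl dep.
have tC := fake_step (receptionist_summary cx rec) GR rec dep GC.
have cV := chain_summary cx rec.
(* Finalization of [C] makes [x] relevant, hence activated, which puts its owner into some summary:
   this owner is the new [G]. *)
have [_ [[/RV.1[d oR] _] _ _]] := fin x tC cV.
exists d, (owner x); split; first exact: (summary_dom (summary d) oR).
- exact: oR.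
- exact: reaches_refl.
- exact: reaches_chainl cV tC.
Qed.

(** From [V] to [U], finalization of [C] itself serves to carry the paths over, and refobs to
    non-receptionists are relevant by potential finalization. Conversely, reachability in [V]
    implies it in [U], and fake refobs are always relevant. *)
Lemma actor_finalized_summary C : C \in domf V ->
  actor_finalized V C <-> actor_finalized U C.
Proof.
move=> CV; split=> fin x xC cx.
  have [b [G [tQ GR dep GC]]] := reaches_summary CV fin xC.
  have [rec|nrec] := pselect (receptionist (Q b) (target x)); last first.
    exact: relevant_local cx tQ nrec.
  apply/(relevant_summary cx rec)/fin; last exact: chain_summary rec.
  exact: fake_step (receptionist_summary cx rec) GR rec dep GC.
have [/fake_relevant//|[cU [b rec]]] := chain_of_summary cx.
exact/(relevant_summary cU rec)/fin/cU/reaches_of_summary.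
Qed.

End Union.

Theorem theorem8p14 (token actor : choiceType)
    (Q1 Q2 R1 R2 : {fmap actor -> {fset fact token actor}})
    (fresh1 fresh2 : actor -> actor -> token)
    (disjoint_dom : [disjoint domf Q1 & domf Q2])
    (no_finalized_subset1 : forall D : {fset actor},
       D `<=` domf Q1 -> D != fset0 -> ~ finalized Q1.[& D])
    (no_finalized_subset2 : forall D : {fset actor},
       D `<=` domf Q2 -> D != fset0 -> ~ finalized Q2.[& D])
    (pot_finalized1 : forall A, A \in domf Q1 -> potentially_finalized Q1 A)
    (pot_finalized2 : forall A, A \in domf Q2 -> potentially_finalized Q2 A)
    (summary1 : is_summary fresh1 Q1 R1)
    (summary2 : is_summary fresh2 Q2 R2)
    (distinct1 : forall A B A' B', fake_pair Q1 R1 A B ->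
       fake_pair Q1 R1 A' B' -> fresh1 A B = fresh1 A' B' -> A = A' /\ B = B')
    (distinct2 : forall A B A' B', fake_pair Q2 R2 A B ->
       fake_pair Q2 R2 A' B' -> fresh2 A B = fresh2 A' B' -> A = A' /\ B = B')
    (distinct12 : forall A B A' B', fake_pair Q1 R1 A B ->
       fake_pair Q2 R2 A' B' -> fresh1 A B <> fresh2 A' B')
    (fresh1P : forall A B, fake_pair Q1 R1 A B ->
       ~ occurs (fresh1 A B) Q1 /\ ~ occurs (fresh1 A B) Q2)
    (fresh2P : forall A B, fake_pair Q2 R2 A B ->
       ~ occurs (fresh2 A B) Q1 /\ ~ occurs (fresh2 A B) Q2) :
  forall C, C \in domf R1 `|` domf R2 ->
    (actor_finalized (R1 + R2) C <-> actor_finalized (Q1 + Q2) C).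

Proof.
pose fresh b := if b then fresh1 else fresh2.
pose Q b := if b then Q1 else Q2.
pose R b := if b then R1 else R2.
have summary b : is_summary (fresh b) (Q b) (R b) by case: b.
have disjoint_Q A b c : A \in domf (Q b) -> A \in domf (Q c) -> b = c.
  by case: b; case: c => //= H H'; have := fdisjointP disjoint_dom A;
    [move/(_ H)|move/(_ H')]; rewrite ?H ?H'.
(* Summaries contain no new actors, so they inherit disjointness. *)
have disjoint_R : [disjoint domf R1 & domf R2].
  apply/fdisjointP => A AR; apply/negP=> AR'.
  have AQ := summary_dom (summary true) AR.
  by have := disjoint_Q A _ _ AQ (summary_dom (summary false) AR').
move=> C CR; apply: (@actor_finalized_summary _ _ fresh Q R).
- exact: is_union_cat.
- exact: is_union_cat.
- exact: disjoint_Q.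
- exact: summary.
- by move=> [] [] A B /= => [/fresh1P|/fresh1P|/fresh2P|/fresh2P] [].
- by case=> [A /pot_finalized1|A /pot_finalized2].
- by rewrite mem_catf -in_fsetU.
Qed.
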